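(* For every $n\ge 3$: $s_n^0(132,213,231)=\left\lfloor\frac n2\right\rfloor+\left(\frac n2-1\right)I_{n\text{ even}}$, $s_n^1(132,213,231)=\left\lfloor\frac n2\right\rfloor I_{n\text{ odd}}$, and $s_n^k(132,213,231)=I_{n=k}$ for all $2\le k\le n$.
   Context: $S_n$ denotes the set of permutations of $\{1,\dots,n\}$ written in one-line notation $\pi=\pi_1\pi_2\cdots\pi_n$. For $\alpha\in S_m$, $\pi\in S_n$ contains the pattern $\alpha$ if there are indices $i_1<i_2<\dots<i_m$ such that $\pi_{i_1}\pi_{i_2}\cdots\pi_{i_m}$ is order-isomorphic to $\alpha$; otherwise $\pi$ avoids $\alpha$. For a set $T$ of patterns, $S_n^k(T)$ is the set of $\pi\in S_n$ that have exactly $k$ fixed points (indices $i$ with $\pi_i=i$) and avoid every pattern in $T$; $s_n^k(T)=|S_n^k(T)|$. The braces around $T$ are omitted, e.g. $s_n^k(132,213,231)=s_n^k(\{132,213,231\})$. For a statement $P$, $I_P=1$ if $P$ is true and $I_P=0$ if $P$ is false. *)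

(* Defs.v *)
From mathcomp Require Import all_boot all_fingroup.

Set Implicit Arguments.
Unset Strict Implicit.
Unset Printing Implicit Defensive.

(* Permutations of {1, ..., n} are elements of 'S_n, which permute {0, ..., n-1}:
   positions and values are both shifted by one, which changes neither fixed
   points nor order isomorphism. *)
Definition one_line n (pi : 'S_n) : seq nat := [seq (pi i).+1 | i <- enum 'I_n].

(* f lists the indices i_1 < ... < i_m of an occurrence of alpha in pi. *)
Definition contains m n (alpha : 'S_m) (pi : 'S_n) : bool :=
  [exists f : {ffun 'I_m -> 'I_n},
     [forall i : 'I_m, forall j : 'I_m, (i < j) ==> (f i < f j)] &&
     [forall i : 'I_m, forall j : 'I_m, (pi (f i) < pi (f j)) == (alpha i < alpha j)]].

Definition avoids m n (alpha : 'S_m) (pi : 'S_n) : bool := ~~ contains alpha pi.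

Definition fixed_points n (pi : 'S_n) : {set 'I_n} := [set i | pi i == i].

Definition avoiders m (n k : nat) (T : {set 'S_m}) : {set 'S_n} :=
  [set pi : 'S_n | (#|fixed_points pi| == k) &&
                   [forall alpha in T, avoids alpha pi]].

Definition num_avoiders m (n k : nat) (T : {set 'S_m}) : nat :=
  #|avoiders n k T|.

Definition word3 (a b c : nat) (i : 'I_3) : 'I_3 :=
  inord (nth 0 [:: a; b; c] i).-1.

Lemma word3_inj a b c :
  perm_eq [:: a; b; c] [:: 1; 2; 3] -> injective (word3 a b c).
Proof.
move=> abcP; have Ub : uniq [:: a; b; c] by rewrite (perm_uniq abcP).
have bnd (i : 'I_3) : 0 < nth 0 [:: a; b; c] i < 4.
  have : nth 0 [:: a; b; c] i \in [:: 1; 2; 3].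
    by rewrite -(perm_mem abcP) mem_nth.
  by rewrite !inE => /or3P[] /eqP->.
move=> i j /(congr1 val) /=.
have /andP[i0 i4] := bnd i; have /andP[j0 j4] := bnd j.
rewrite !inordK ?prednK // => /(congr1 S); rewrite !prednK // => /eqP.
by rewrite nth_uniq // => /eqP/val_inj.
Qed.

Definition p132 : 'S_3 := perm (@word3_inj 1 3 2 isT).
Definition p213 : 'S_3 := perm (@word3_inj 2 1 3 isT).
Definition p231 : 'S_3 := perm (@word3_inj 2 3 1 isT).

Lemma one_line_p132 : one_line p132 = [:: 1; 3; 2].
Proof. by rewrite /one_line !enum_ordSl enum_ord0 /= !permE /word3 /= !inordK. Qed.

Lemma one_line_p213 : one_line p213 = [:: 2; 1; 3].
Proof. by rewrite /one_line !enum_ordSl enum_ord0 /= !permE /word3 /= !inordK. Qed.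

Lemma one_line_p231 : one_line p231 = [:: 2; 3; 1].
Proof. by rewrite /one_line !enum_ordSl enum_ord0 /= !permE /word3 /= !inordK. Qed.

(* Main.v *)
Require Import Defs.
From mathcomp Require Import all_boot all_fingroup.
From mathcomp Require Import zify.

(** The avoiders of 132, 213 and 231 in S_n are the n valley permutations
    n, n-1, ..., n-d+1, 1, 2, ..., n-d (0 <= d < n): a descending run of the
    largest values, followed by the remaining values in increasing order.
    Indeed let d be the position of the smallest value.  A descent to its right
    would complete it to a 132, an ascent to its left would complete it to a
    231, and a smaller entry on its left together with a larger entry on its
    right would be the outer letters of a 213.  So the comparison of the entries
    at positions i < j depends only on i: it is an ascent exactly when d <= i
    ([pattern_freeP]).  A permutation is determined by all such comparisons
    ([perm_order_inj]), which leaves one avoider for each d ([avoidersE]).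

    It remains to count fixed points.  For d = 0 the valley is the identity.
    For d > 0 the increasing run is shifted by d and has none, while the
    decreasing run agrees with the reversal, whose only possible fixed point is
    the middle position: it exists when n is odd and must lie in the run
    ([card_fixed_valley]).  Hence each condition on the number of fixed points
    selects an interval of values of d, whose length is the required number. *)

Lemma card_ord_interval n a b :
  b <= n -> #|[set i : 'I_n | a <= i < b]| = b - a.
Proof.
move=> le_bn; rewrite -sum1dep_card.
rewrite -(big_mkord (fun i => a <= i < b) (fun=> 1)).
rewrite -[RHS]muln1 -sum_nat_const_nat [RHS](big_nat_widen _ _ n) //.
by rewrite [RHS](big_nat_widenl a 0) //; apply: eq_bigl => i; rewrite andbC.
Qed.

Lemma perm_ltnNge n (p : 'S_n) i j : i != j -> (p i < p j) = ~~ (p j < p i).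
Proof.
by move=> neq_ij; rewrite ltn_neqAle -leqNgt val_eqE (inj_eq perm_inj) neq_ij.
Qed.

(** The value of a permutation at i is the number of smaller values, and these
    can be counted by position. *)
Lemma perm_order_inj n (p q : 'S_n) :
  (forall i j : 'I_n, i < j -> (p i < p j) = (q i < q j)) -> p = q.
Proof.
move=> eq_lt.
have rank (r : 'S_n) i : r i = #|[set j | r j < r i]| :> nat.
  have := card_ord_interval n 0 (r i) (ltnW (ltn_ord (r i))).
  rewrite subn0 => {1}<-; rewrite -[LHS](card_preimset _ (@perm_inj _ r)).
  by apply: eq_card => j; rewrite !inE.
apply/permP => i; apply: val_inj; rewrite /= [LHS]rank [RHS]rank; apply: eq_card => j.
rewrite !inE; case: (ltngtP i j) => [lt_ij|lt_ji|/val_inj->]; last by rewrite !ltnn.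
- by rewrite perm_ltnNge 1?[RHS]perm_ltnNge ?eq_lt // neq_ltn lt_ij orbT.
- by rewrite eq_lt.
Qed.

Lemma ord3_cases (P : 'I_3 -> Prop) :
  P (@Ordinal 3 0 isT) -> P (@Ordinal 3 1 isT) -> P (@Ordinal 3 2 isT) ->
  forall s, P s.
Proof.
by move=> P0 P1 P2 [[|[|[|//]]] lt_s3]; rewrite (bool_irrelevance lt_s3 isT).
Qed.

(** Only the comparisons of increasing pairs of positions matter: the others
    are their negations. *)
Lemma contains3P n (a : 'S_3) (p : 'S_n) :
  let a0 := a (@Ordinal 3 0 isT) in
  let a1 := a (@Ordinal 3 1 isT) in
  let a2 := a (@Ordinal 3 2 isT) in
  reflect (exists i j k : 'I_n,
             [/\ i < j, j < k, (p i < p j) = (a0 < a1),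
                 (p j < p k) = (a1 < a2) & (p i < p k) = (a0 < a2)])
          (contains a p).
Proof.
move=> a0 a1 a2; apply: (iffP existsP).
  case=> f /andP[/forallP incf /forallP ordf].
  have lt_f (s t : 'I_3) : s < t -> f s < f t by apply/implyP/(forallP (incf s)).
  have eq_f s t : (p (f s) < p (f t)) = (a s < a t).
    by have /forallP/(_ t)/eqP := ordf s.
  exists (f (@Ordinal 3 0 isT)), (f (@Ordinal 3 1 isT)), (f (@Ordinal 3 2 isT)).
  by split; rewrite ?lt_f ?eq_f.
case=> i [j [k [lt_ij lt_jk eq_ij eq_jk eq_ik]]].
have lt_ik := ltn_trans lt_ij lt_jk.
exists [ffun s : 'I_3 => nth i [:: i; j; k] s].
apply/andP; split; apply/forallP; elim/ord3_cases; apply/forallP;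
  elim/ord3_cases; rewrite !ffunE //= ?ltnn //.
- by rewrite eq_ij.
- by rewrite eq_ik.
- by rewrite perm_ltnNge ?eq_ij -?perm_ltnNge // neq_ltn lt_ij orbT.
- by rewrite eq_jk.
- by rewrite perm_ltnNge ?eq_ik -?perm_ltnNge // neq_ltn lt_ik orbT.
- by rewrite perm_ltnNge ?eq_jk -?perm_ltnNge // neq_ltn lt_jk orbT.
Qed.

Definition valley_fun n (d i : 'I_n.+1) : 'I_n.+1 :=
  inord (if i < d then n - i else i - d).

Lemma val_valley_fun n (d i : 'I_n.+1) :
  valley_fun n d i = (if i < d then n - i else i - d) :> nat.
Proof. by rewrite inordK //; case: ifP => _; move: (ltn_ord i); lia. Qed.

Lemma valley_fun_inj n (d : 'I_n.+1) : injective (valley_fun n d).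
Proof.
move=> i j /(congr1 val); rewrite /= !val_valley_fun => eq_ij.
apply: val_inj => /=; move: eq_ij (ltn_ord i) (ltn_ord j) (ltn_ord d).
by do 2 case: ifP; lia.
Qed.

Definition valley n (d : 'I_n.+1) : 'S_n.+1 := perm (valley_fun_inj n d).

Lemma valleyE n (d i : 'I_n.+1) :
  valley n d i = (if i < d then n - i else i - d) :> nat.
Proof. by rewrite permE val_valley_fun. Qed.

Lemma valley_order n (d i j : 'I_n.+1) :
  i < j -> (valley n d i < valley n d j) = (d <= i).
Proof.
move=> lt_ij; rewrite !valleyE; move: (ltn_ord j) (ltn_ord d).
by do 2 case: ifP; lia.
Qed.

(** The valley attains its smallest value at d only. *)
Lemma valley_inj n : injective (valley n).
Proof.
move=> d e eq_de; have := valleyE n e d; rewrite -eq_de valleyE ltnn subnn.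
move: (ltn_ord d) (ltn_ord e) => lt_dn lt_en eq0; apply: val_inj => /=.
have := valleyE n d e; rewrite eq_de valleyE ltnn subnn.
move: eq0; do 2 case: ifP; lia.
Qed.

Definition pattern_free {n} (p : 'S_n) :=
  [forall alpha in [set p132; p213; p231], avoids alpha p].

(** The witness d is the position of the smallest value.  For the converse, in
    a valley all pairs of positions that start at the same i agree on being
    ascents or descents, and past an ascent there are only ascents; but 213 and
    231 have an ascent and a descent that both start at their first letter, and
    132 has an ascent followed by a descent. *)
Lemma pattern_freeP n (p : 'S_n.+1) :
  reflect (exists d : 'I_n.+1,
             forall i j : 'I_n.+1, i < j -> (p i < p j) = (d <= i))
          (pattern_free p).
Proof.
apply: (iffP forallP) => [free|[d ord_p] alpha].
  have {}free a : a \in [set p132; p213; p231] -> ~ contains a p.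
    by move=> a_in; apply/negP; have /implyP := free a; apply.
  pose d := (p^-1)%g ord0; have pd : p d = ord0 by rewrite permKV.
  have min_d i : i != d -> p d < p i.
    rewrite pd lt0n; apply: contra => /eqP pi0; apply/eqP/(@perm_inj _ p).
    by rewrite pd; apply: val_inj.
  exists d => i j lt_ij; apply/idP/idP => [asc|le_di].
    rewrite leqNgt; apply/negP => lt_id.
    have min_j : j != d -> p d < p j by apply: min_d.
    have min_i : p d < p i by apply: min_d; rewrite neq_ltn lt_id.
    case: (ltngtP j d) => [lt_jd|lt_dj|/val_inj eq_jd].
    - apply: (free p231); first by rewrite !inE eqxx !orbT.
      apply/contains3P; exists i, j, d.
      rewrite !permE /word3 !inordK //=.
      by split=> //; lia.
    - apply: (free p213); first by rewrite !inE eqxx !orbT.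
      apply/contains3P; exists i, d, j.
      rewrite !permE /word3 !inordK //=.
      by split=> //; lia.
    - by rewrite eq_jd in asc; lia.
  case: (eqVneq d i) => [eq_di|neq_di].
    by rewrite -eq_di min_d // neq_ltn eq_di lt_ij orbT.
  have lt_di : d < i by rewrite ltn_neqAle le_di andbT.
  rewrite perm_ltnNge ?neq_ltn ?lt_ij //; apply/negP => desc.
  apply: (free p132); first by rewrite !inE eqxx.
  apply/contains3P; exists d, i, j.
  have min_i : p d < p i by apply: min_d; rewrite eq_sym.
  have min_j : p d < p j.
    by apply: min_d; rewrite neq_ltn (ltn_trans lt_di lt_ij) orbT.
  rewrite !permE /word3 !inordK //=.
  by split=> //; lia.
apply/implyP; rewrite !inE => alpha_in; apply/contains3P => -[i [j [k [lt_ij lt_jk]]]].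
rewrite !ord_p ?(ltn_trans lt_ij lt_jk) //.
by case/orP: alpha_in => [/orP[]|] /eqP->; rewrite !permE /word3 !inordK //=; lia.
Qed.

Lemma avoidersE n k :
  avoiders n.+1 k [set p132; p213; p231] =
    valley n @: [set d | #|fixed_points (valley n d)| == k].
Proof.
apply/setP => p; rewrite inE; apply/andP/imsetP => [[fix_p /pattern_freeP[d ord_p]]|[d]].
  have eq_p : p = valley n d.
    by apply: perm_order_inj => i j lt_ij; rewrite ord_p ?valley_order.
  by exists d; rewrite // inE -eq_p.
rewrite inE => fix_d ->; split=> //; apply/pattern_freeP.
by exists d => i j; apply: valley_order.
Qed.

Lemma card_fixed_valley n (d : 'I_n.+1) :
  #|fixed_points (valley n d)| =
    if d == 0 :> nat then n.+1 else (~~ odd n) && (n./2 < d).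
Proof.
case: eqP => [d0|/eqP d_neq0].
  rewrite -[RHS]card_ord -cardsT; apply: eq_card => i; rewrite !inE.
  by rewrite -val_eqE /= valleyE d0 ltn0 subn0 eqxx.
have lt_dn := ltn_ord d.
have fixE i : (i \in fixed_points (valley n d)) = (i < d) && (n == i.*2).
  rewrite inE -val_eqE /= valleyE; move: (ltn_ord i).
  by case: ifP; lia.
case: (boolP (~~ odd n && _)) => [/andP[even_n lt_nd]|no_middle] /=.
  have lt_n : n./2 < n.+1 by lia.
  rewrite -(cards1 (Ordinal lt_n)); apply: eq_card => i.
  by rewrite fixE !inE -val_eqE /=; lia.
by apply: eq_card0 => i; rewrite fixE inE; lia.
Qed.

Lemma num_avoiders_interval n k a b :
  b <= n.+1 ->
  (forall d : 'I_n.+1, (#|fixed_points (valley n d)| == k) = (a <= d < b)) ->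
  num_avoiders n.+1 k [set p132; p213; p231] = b - a.
Proof.
move=> le_bn fixP; rewrite /num_avoiders avoidersE card_imset; last first.
  exact: valley_inj.
by rewrite -(card_ord_interval _ a _ le_bn); apply: eq_card => d; rewrite !inE fixP.
Qed.

Theorem theorem3p5 (n : nat) (hn : 3 <= n) :
  [/\ num_avoiders n 0 [set p132; p213; p231] =
        n %/ 2 + (n %/ 2 - 1) * ~~ odd n,
      num_avoiders n 1 [set p132; p213; p231] = n %/ 2 * odd n &
      forall k : nat, 2 <= k <= n ->
        num_avoiders n k [set p132; p213; p231] = (n == k)].
Proof.
(* From here on the size is n.+1, so odd n means that the size is even and the
   reversal has no middle position. *)
case: n hn => [//|n] hn; split=> [||k /andP[le2k le_kn]].
- rewrite (@num_avoiders_interval n 0 1 (if odd n then n.+1 else n./2.+1)).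
  + by rewrite divn2 /= uphalf_half; have := odd_double_half n; case: (odd n); lia.
  + by case: ifP; lia.
  + by move=> d; rewrite card_fixed_valley; move: (ltn_ord d); do 2 case: ifP; lia.
- rewrite (@num_avoiders_interval n 1 n./2.+1 (if odd n then 0 else n.+1)).
  + by rewrite divn2 /= uphalf_half; have := odd_double_half n; case: (odd n); lia.
  + by case: ifP; lia.
  + by move=> d; rewrite card_fixed_valley; move: (ltn_ord d); do 2 case: ifP; lia.
- rewrite (@num_avoiders_interval n k 0 (n.+1 == k)); first by rewrite subn0.
  + by lia.
  + by move=> d; rewrite card_fixed_valley; move: (ltn_ord d); case: ifP; lia.
Qed.
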